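(* The center defines a lax functor $Z\colon \mathsf{Ring}\to\mathsf{Morita}$. That is, the following data form a lax functor from $\mathsf{Ring}$ (regarded as a bicategory with only identity 2-morphisms) to the bicategory $\mathsf{Morita}$: (i) a ring $R$ is sent to its center $Z(R)$; (ii) a ring homomorphism $f\colon R\to S$ is sent to its centralizer $Z(f)=\{s\in S \mid s f(r)=f(r)s \text{ for all } r\in R\}$, regarded as a $(Z(S),Z(R))$-bimodule, i.e. as a 1-morphism $Z(R)\to Z(S)$ in $\mathsf{Morita}$; (iii) for each ring $R$ the unit 2-cell $\mathrm{id}_{Z(R)}\Rightarrow Z(\mathrm{id}_R)$ is the identity of the $(Z(R),Z(R))$-bimodule $Z(R)=Z(\mathrm{id}_R)$; (iv) for ring homomorphisms $f\colon R\to S$ and $g\colon S\to T$ the composition 2-cell is the canonical map $\mu\colon Z(g)\otimes_{Z(S)}Z(f)\to Z(g\circ f)$, $\mu(t\otimes s)=t\,g(s)$.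
   Context: Rings are unital and associative (not necessarily commutative); ring homomorphisms preserve the unit; $\mathsf{Ring}$ is the category of such rings. $Z(R)$ denotes the center of $R$. For a ring homomorphism $f\colon R\to S$, the $(Z(S),Z(R))$-bimodule structure on $Z(f)$ is: $s\cdot x=sx$ (product in $S$) for $s\in Z(S)$, $x\in Z(f)$, and $x\cdot r=x f(r)$ for $r\in Z(R)$, $x\in Z(f)$. The bicategory $\mathsf{Morita}$: objects are rings; the 1-morphisms from $R$ to $S$ are $(S,R)$-bimodules (left $S$-action, right $R$-action); 2-morphisms are bimodule homomorphisms; the composite of an $(S,R)$-bimodule $M\colon R\to S$ with a $(T,S)$-bimodule $N\colon S\to T$ is $N\circ M=N\otimes_S M$; the identity 1-morphism of $R$ is $R$ with its standard $(R,R)$-bimodule structure; the associator and unitors are the standard isomorphisms for tensor products. A lax functor $P\colon\mathcal A\to\mathcal B$ between bicategories consists of: a function $P$ on objects; functors $P_{X,Y}\colon\mathcal A(X,Y)\to\mathcal B(P(X),P(Y))$ on hom-categories (all written $P$ below); for each object $X$ a 2-cell $P_{\mathrm{id}_X}\colon \mathrm{id}_{P(X)}\Rightarrow P(\mathrm{id}_X)$; and for composable $f\colon X\to Y$, $g\colon Y\to Z$ a 2-cell $P_{g,f}\colon P(g)\circ P(f)\Rightarrow P(g\circ f)$, natural in $f$ and $g$. With $\alpha\colon (h\circ g)\circ f\Rightarrow h\circ(g\circ f)$ the associator and $\ell\colon \mathrm{id}\circ f\Rightarrow f$, $r\colon f\circ\mathrm{id}\Rightarrow f$ the unitors, and $*$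 denoting horizontal composition, these must satisfy, for $f\colon W\to X$, $g\colon X\to Y$, $h\colon Y\to Z$: (Lax unity) $P(\ell_{\mathcal A})\cdot P_{\mathrm{id}_X,f}\cdot(P_{\mathrm{id}_X}*\mathrm{id}_{P(f)})=\ell_{\mathcal B}$ and $P(r_{\mathcal A})\cdot P_{f,\mathrm{id}_W}\cdot(\mathrm{id}_{P(f)}*P_{\mathrm{id}_W})=r_{\mathcal B}$; (Lax associativity) $P(\alpha_{\mathcal A})\cdot P_{h\circ g,f}\cdot(P_{h,g}*\mathrm{id}_{P(f)})=P_{h,g\circ f}\cdot(\mathrm{id}_{P(h)}*P_{g,f})\cdot\alpha_{\mathcal B}$. *)

(* Defs.v *)
From HB Require Import structures.
Set Warnings "-notation-overridden,-ambiguous-paths,-redundant-canonical-projection,-projection-no-head-constant".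
From mathcomp Require Import all_boot all_algebra boolp.
From mathcomp Require Import freeg.

Set Implicit Arguments.
Unset Strict Implicit.
Unset Printing Implicit Defensive.

Import GRing.Theory.
Local Open Scope ring_scope.
Local Open Scope quotient_scope.

(* As usual for composition, the first argument of [comp1], [vcomp] and [hcomp]
   is the one applied last. *)
Record bicat_data := BicatData {
  ob :> Type;
  hom : ob -> ob -> Type;
  cell : forall X Y, hom X Y -> hom X Y -> Type;
  id1 : forall X, hom X X;
  comp1 : forall X Y Z, hom Y Z -> hom X Y -> hom X Z;
  id2 : forall X Y (f : hom X Y), cell f f;
  vcomp : forall X Y (f g h : hom X Y), cell g h -> cell f g -> cell f h;
  hcomp : forall X Y Z (g g' : hom Y Z) (f f' : hom X Y),
    cell g g' -> cell f f' -> cell (comp1 g f) (comp1 g' f');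
  assoc : forall W X Y Z (h : hom Y Z) (g : hom X Y) (f : hom W X),
    cell (comp1 (comp1 h g) f) (comp1 h (comp1 g f));
  lunit : forall X Y (f : hom X Y), cell (comp1 (id1 Y) f) f;
  runit : forall X Y (f : hom X Y), cell (comp1 f (id1 X)) f
}.

Declare Scope bicat_scope.
Delimit Scope bicat_scope with B.
Arguments id1 {_} X.
Arguments id2 {_ X Y} f.
Arguments assoc {_ W X Y Z} h g f.
Arguments lunit {_ X Y} f.
Arguments runit {_ X Y} f.
Notation "g \o1 f" := (comp1 g f)
  (at level 50, format "g  \o1  f") : bicat_scope.
Notation "b \v a" := (vcomp b a)
  (at level 53, left associativity, format "b  \v  a") : bicat_scope.
Notation "b \h a" := (hcomp b a)
  (at level 52, left associativity, format "b  \h  a") : bicat_scope.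

Section BicatLaws.
Local Open Scope bicat_scope.

Definition is_iso2 (B : bicat_data) (X Y : B) (f g : hom X Y) (a : cell f g) :=
  exists b : cell g f, b \v a = id2 f /\ a \v b = id2 g.

Record is_bicat (B : bicat_data) : Prop := IsBicat {
  vcompA : forall (X Y : B) (f g h k : hom X Y)
    (c : cell h k) (b : cell g h) (a : cell f g), c \v (b \v a) = c \v b \v a;
  vcomp1l : forall (X Y : B) (f g : hom X Y) (a : cell f g), id2 g \v a = a;
  vcomp1r : forall (X Y : B) (f g : hom X Y) (a : cell f g), a \v id2 f = a;
  hcomp1 : forall (X Y Z : B) (g : hom Y Z) (f : hom X Y),
    id2 g \h id2 f = id2 (g \o1 f);
  hcompV : forall (X Y Z : B) (g g' g'' : hom Y Z) (f f' f'' : hom X Y)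
    (b' : cell g' g'') (b : cell g g') (a' : cell f' f'') (a : cell f f'),
    (b' \v b) \h (a' \v a) = (b' \h a') \v (b \h a);
  assoc_nat : forall (W X Y Z : B) (h h' : hom Y Z) (g g' : hom X Y)
    (f f' : hom W X) (c : cell h h') (b : cell g g') (a : cell f f'),
    assoc h' g' f' \v (c \h b \h a) = (c \h (b \h a)) \v assoc h g f;
  assoc_iso : forall (W X Y Z : B) (h : hom Y Z) (g : hom X Y) (f : hom W X),
    is_iso2 (assoc h g f);
  lunit_nat : forall (X Y : B) (f f' : hom X Y) (a : cell f f'),
    lunit f' \v (id2 (id1 Y) \h a) = a \v lunit f;
  lunit_iso : forall (X Y : B) (f : hom X Y), is_iso2 (lunit f);
  runit_nat : forall (X Y : B) (f f' : hom X Y) (a : cell f f'),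
    runit f' \v (a \h id2 (id1 X)) = a \v runit f;
  runit_iso : forall (X Y : B) (f : hom X Y), is_iso2 (runit f);
  triangle : forall (X Y Z : B) (g : hom Y Z) (f : hom X Y),
    (id2 g \h lunit f) \v assoc g (id1 Y) f = runit g \h id2 f;
  pentagon : forall (V W X Y Z : B) (k : hom Y Z) (h : hom X Y) (g : hom W X)
    (f : hom V W),
    (id2 k \h assoc h g f) \v assoc k (h \o1 g) f \v (assoc k h g \h id2 f) =
    assoc k h (g \o1 f) \v assoc (k \o1 h) g f
}.

Record bicategory := Bicategory {
  bicat_of :> bicat_data;
  bicategoryP : is_bicat bicat_of
}.

Record lax_data (A B : bicategory) := LaxData {
  lax_ob :> A -> B;
  lax_hom : forall X Y : A, hom X Y -> hom (lax_ob X) (lax_ob Y);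
  lax_cell : forall (X Y : A) (f g : hom X Y),
    cell f g -> cell (lax_hom f) (lax_hom g);
  lax_unit : forall X : A, cell (id1 (lax_ob X)) (lax_hom (id1 X));
  lax_comp : forall (X Y Z : A) (g : hom Y Z) (f : hom X Y),
    cell (lax_hom g \o1 lax_hom f) (lax_hom (g \o1 f))
}.

Arguments lax_hom {A B} l {X Y} f.
Arguments lax_cell {A B} l {X Y f g} a.
Arguments lax_unit {A B} l X.
Arguments lax_comp {A B} l {X Y Z} g f.

Record is_lax_functor (A B : bicategory) (P : lax_data A B) : Prop :=
  IsLaxFunctor {
  lax_cell1 : forall (X Y : A) (f : hom X Y),
    lax_cell P (id2 f) = id2 (lax_hom P f);
  lax_cellV : forall (X Y : A) (f g h : hom X Y) (b : cell g h) (a : cell f g),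
    lax_cell P (b \v a) = lax_cell P b \v lax_cell P a;
  lax_comp_nat : forall (X Y Z : A) (g g' : hom Y Z) (f f' : hom X Y)
    (b : cell g g') (a : cell f f'),
    lax_comp P g' f' \v (lax_cell P b \h lax_cell P a) =
    lax_cell P (b \h a) \v lax_comp P g f;
  lax_unityl : forall (W X : A) (f : hom W X),
    lax_cell P (lunit f) \v lax_comp P (id1 X) f
      \v (lax_unit P X \h id2 (lax_hom P f)) = lunit (lax_hom P f);
  lax_unityr : forall (W X : A) (f : hom W X),
    lax_cell P (runit f) \v lax_comp P f (id1 W)
      \v (id2 (lax_hom P f) \h lax_unit P W) = runit (lax_hom P f);
  lax_assoc : forall (W X Y Z : A) (h : hom Y Z) (g : hom X Y) (f : hom W X),
    lax_cell P (assoc h g f) \v lax_comp P (h \o1 g) f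
      \v (lax_comp P h g \h id2 (lax_hom P f)) =
    lax_comp P h (g \o1 f) \v (id2 (lax_hom P h) \h lax_comp P g f)
      \v assoc (lax_hom P h) (lax_hom P g) (lax_hom P f)
}.

End BicatLaws.

Lemma rmorph_eq (R S : pzRingType) (f g : {rmorphism R -> S}) : f =1 g -> f = g.
Proof.
case: f g => [f [[f1] [f2]]] [g [[g1] [g2]]] /= /funext fg.
case: g / fg g1 g2 => g1 g2.
by congr (GRing.RMorphism.Pack (GRing.RMorphism.Class _ _)); congr (_ _);
  apply: Prop_irrelevance.
Qed.

Section RingCat.
Variables Q R S T : pzRingType.

Definition rmorph_id : {rmorphism R -> R} := GRing.RMorphism.clone R R idfun _.

Definition rmorph_comp (g : {rmorphism S -> T}) (f : {rmorphism R -> S}) :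
  {rmorphism R -> T} := GRing.RMorphism.clone R T (g \o f) _.

End RingCat.

Lemma rmorph_compA (Q R S T : pzRingType) (h : {rmorphism S -> T})
    (g : {rmorphism R -> S}) (f : {rmorphism Q -> R}) :
  rmorph_comp (rmorph_comp h g) f = rmorph_comp h (rmorph_comp g f).
Proof. exact: rmorph_eq. Qed.

Lemma rmorph_comp1l (R S : pzRingType) (f : {rmorphism R -> S}) :
  rmorph_comp (rmorph_id S) f = f.
Proof. exact: rmorph_eq. Qed.

Lemma rmorph_comp1r (R S : pzRingType) (f : {rmorphism R -> S}) :
  rmorph_comp f (rmorph_id R) = f.
Proof. exact: rmorph_eq. Qed.

(* 2-cells are equalities, so that only identity 2-cells exist. *)
Definition ring_bicat_data : bicat_data := {|
  ob := pzRingType;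
  hom := fun R S => {rmorphism R -> S};
  cell := fun R S f g => f = g;
  id1 := rmorph_id;
  comp1 := rmorph_comp;
  id2 := fun R S f => erefl f;
  vcomp := fun R S f g h b a => etrans a b;
  hcomp := fun R S T g g' f f' b a =>
    let: erefl := b in let: erefl := a in erefl (rmorph_comp g f);
  assoc := rmorph_compA;
  lunit := rmorph_comp1l;
  runit := rmorph_comp1r
|}.

Lemma ring_is_bicat : is_bicat ring_bicat_data.
Proof.
have eq_irr (R S : pzRingType) (f g : {rmorphism R -> S})
  (p q : @cell ring_bicat_data R S f g) : p = q.
  exact: (@Prop_irrelevance (f = g)).
have iso (R S : pzRingType) (f g : {rmorphism R -> S}) (e : f = g) :
    @is_iso2 ring_bicat_data R S f g e.
  by exists (esym e); split; apply: eq_irr.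
by split=> *; try exact: eq_irr; apply: iso.
Qed.

Definition ring_bicat : bicategory := Bicategory ring_is_bicat.

(* An (S, R)-bimodule: a left S-module with a commuting right R-action. *)
HB.mixin Record Lmodule_isBimodule (S R : pzRingType) M
    of GRing.Lmodule S M := {
  ract : M -> R -> M;
  ractDl : forall r, {morph ract^~ r : x y / x + y};
  ractDr : forall x, {morph ract x : r s / r + s};
  ractA : forall x r s, ract (ract x r) s = ract x (r * s);
  ract1 : forall x, ract x 1 = x;
  scaler_ractA : forall s x r, ract (s *: x) r = s *: ract x r
}.

#[short(type="bimodType")]
HB.structure Definition Bimodule (S R : pzRingType) :=
  {M of GRing.Lmodule S M & Lmodule_isBimodule S R M}.

Notation "x :* r" := (ract x r) : ring_scope.

Record bimod_hom (S R : pzRingType) (M N : bimodType S R) := BimodHom {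
  bimod_fun :> {linear M -> N};
  bimod_funR : forall x r, bimod_fun (x :* r) = bimod_fun x :* r
}.

Section BimodHomTheory.
Variables S R : pzRingType.
Implicit Types M N P : bimodType S R.

Lemma bimod_hom_eq M N (f g : bimod_hom M N) : f =1 g -> f = g.
Proof.
case: f g => [[f [[f1] [f2]]] f3] [[g [[g1] [g2]]] g3] /= /funext fg.
case: g / fg g1 g2 g3 => g1 g2.
rewrite (Prop_irrelevance g1 f1) (Prop_irrelevance g2 f2) => g3.
by rewrite (Prop_irrelevance g3 f3).
Qed.

Section Mk.
Variables (M N : bimodType S R) (f : M -> N) (lf : linear f).
Hypothesis rf : forall x r, f (x :* r) = f x :* r.

Definition mk_bimod_hom : bimod_hom M N :=
  @BimodHom S R M N (HB.pack_for {linear M -> N} f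
    (GRing.isLinear.Build S M N *:%R f lf)) rf.

Lemma mk_bimod_homE x : mk_bimod_hom x = f x. Proof. by []. Qed.

End Mk.

Definition bimod_id M : bimod_hom M M :=
  @BimodHom S R M M idfun (fun _ _ => erefl).

Definition bimod_comp M N P (g : bimod_hom N P) (f : bimod_hom M N) :
  bimod_hom M P.
Proof.
exists (g \o f) => x r.
by rewrite /= !bimod_funR.
Defined.

End BimodHomTheory.

Section Tensor.
Variables (T S R : pzRingType) (N : bimodType T S) (M : bimodType S R).

Local Notation gen n m := << (n, m) >>.

(* The subgroup of the free abelian group on N * M generated by the usual
   relations; the tensor product over S is the quotient by it. *)
Inductive tens_rel : {freeg (N * M)%type / int} -> Prop :=
| tens_rel0 : tens_rel 0
| tens_relB x y : tens_rel x -> tens_rel y -> tens_rel (x - y)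
| tens_relDl n n' m : tens_rel (gen (n + n') m - (gen n m + gen n' m))
| tens_relDr n m m' : tens_rel (gen n (m + m') - (gen n m + gen n m'))
| tens_relA n s m : tens_rel (gen (n :* s) m - gen n (s *: m)).

Definition tens_pred (x : {freeg (N * M)%type / int}) : bool := `[< tens_rel x >].

Fact tens_pred_closed : zmod_closed tens_pred.
Proof.
split; first by apply/asboolP; apply: tens_rel0.
by move=> x y /asboolP rx /asboolP ry; apply/asboolP; apply: tens_relB.
Qed.

HB.instance Definition _ := GRing.isZmodClosed.Build _ tens_pred
  tens_pred_closed.

Definition tens_closed := GRing.ZmodClosed.clone _ tens_pred _.

Definition tensor := Quotient.quot tens_closed.

Local Notation piT := (\pi_(Quotient.quot tens_closed)).

HB.instance Definition _ := GRing.Zmodule.on tensor.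

Definition tens (n : N) (m : M) : tensor := piT (gen n m).

Lemma tens_piP x y : tens_rel (x - y) ->
  piT x = piT y.
Proof.
by move=> r; apply/eqP; rewrite -Quotient.idealrBE; apply/asboolP.
Qed.

Lemma tensDl n n' m : tens (n + n') m = tens n m + tens n' m.
Proof. by rewrite /tens -raddfD; apply: tens_piP; apply: tens_relDl. Qed.

Lemma tensDr n m m' : tens n (m + m') = tens n m + tens n m'.
Proof. by rewrite /tens -raddfD; apply: tens_piP; apply: tens_relDr. Qed.

Lemma tensA n s m : tens (n :* s) m = tens n (s *: m).
Proof. by apply: tens_piP; apply: tens_relA. Qed.

Lemma tens0l m : tens 0 m = 0.
Proof. by apply: (addrI (tens 0 m)); rewrite -tensDl !addr0. Qed.

Lemma tensNl n m : tens (- n) m = - tens n m.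
Proof. by apply: (addrI (tens n m)); rewrite -tensDl !subrr tens0l. Qed.

Lemma tens_ind (P : tensor -> Prop) :
    (forall n m, P (tens n m)) -> (forall x y, P x -> P y -> P (x + y)) ->
  forall x, P x.
Proof.
move=> Pt PD x; rewrite -[x]reprK; elim/quotW: x => x.
rewrite reprK.
have P0 : P 0 by rewrite -(tens0l 0).
have PN k n m : P (piT (<< k *g (n, m) >>)).
  have Pn (j : nat) : P (piT (<< (Posz j) *g (n, m) >>)).
    elim: j => [|j IH]; first by rewrite freegU0 raddf0.
    by rewrite intS -freegUD raddfD; apply: PD IH; apply: Pt.
  case: k => // j; rewrite NegzE.
  elim: {j}j.+1 => [|j IH]; first by rewrite oppr0 freegU0 raddf0.
  rewrite intS opprD -freegUD raddfD; apply: PD IH.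
  by rewrite -freegUN raddfN /= -[X in P (- X)]/(tens n m) -tensNl.
rewrite -[x]freeg_sumE raddf_sum.
by elim/big_ind: _ => // -[n m] _; apply: PN.
Qed.

Record balanced (A : zmodType) (phi : N -> M -> A) : Prop := Balanced {
  balancedDl : forall n n' m, phi (n + n') m = phi n m + phi n' m;
  balancedDr : forall n m m', phi n (m + m') = phi n m + phi n m';
  balancedA : forall n s m, phi (n :* s) m = phi n (s *: m)
}.

Lemma tens_balanced : balanced tens.
Proof. by split; [apply: tensDl | apply: tensDr | apply: tensA]. Qed.

Section Lift.
Variables (A : zmodType) (phi : N -> M -> A).

(* Only meaningful when phi is balanced: cf. tens_liftE and tens_liftD. *)
Definition tens_lift (x : tensor) : A :=
  fglift (fun p => phi p.1 p.2 : zmodule A) (repr x).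

Hypothesis phiP : balanced phi.

Let flift := fglift (fun p => phi p.1 p.2 : zmodule A).

Let fliftB x y : flift (x - y) = flift x - flift y.
Proof. exact: lift_is_additive. Qed.

Let fliftN x : flift (- x) = - flift x.
Proof. by rewrite -[- x]sub0r fliftB -{1}(subrr 0) fliftB subrr sub0r. Qed.

Let fliftD x y : flift (x + y) = flift x + flift y.
Proof. by rewrite -[y in LHS]opprK fliftB fliftN opprK. Qed.

Let fliftU n m : flift (gen n m) = phi n m.
Proof. by rewrite /flift liftU scale1r. Qed.

Let flift_rel x : tens_rel x -> flift x = 0.
Proof.
elim=> [|{}x y _ IHx _ IHy|n n' m|n m m'|n s m].
- by rewrite -(subrr 0) fliftB subrr.
- by rewrite fliftB IHx IHy subr0.
- by rewrite fliftB fliftD !fliftU (balancedDl phiP) subrr.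
- by rewrite fliftB fliftD !fliftU (balancedDr phiP) subrr.
- by rewrite fliftB !fliftU (balancedA phiP) subrr.
Qed.

Let tens_lift_pi x : tens_lift (piT x) = flift x.
Proof.
apply/eqP; rewrite -subr_eq0 -fliftB; apply/eqP/flift_rel/asboolP.
by have /eqP := reprK (piT x); rewrite -Quotient.idealrBE.
Qed.

Lemma tens_liftE n m : tens_lift (tens n m) = phi n m.
Proof. by rewrite tens_lift_pi fliftU. Qed.

Lemma tens_liftD x y : tens_lift (x + y) = tens_lift x + tens_lift y.
Proof.
by rewrite -[x]reprK -[y]reprK -raddfD !tens_lift_pi fliftD.
Qed.

End Lift.
End Tensor.

Section TensorBimodule.
Variables (T S R : pzRingType) (N : bimodType T S) (M : bimodType S R).
Local Notation NM := (tensor N M).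

Definition tens_scale (t : T) : NM -> NM :=
  tens_lift (fun n m => tens (t *: n) m).

Definition tens_ract (x : NM) (r : R) : NM :=
  tens_lift (fun n m => tens n (m :* r)) x.

Lemma tens_scale_balanced t : balanced (fun (n : N) (m : M) => tens (t *: n) m).
Proof.
split=> [n n' m|n m m'|n s m]; first by rewrite scalerDr tensDl.
  by rewrite tensDr.
by rewrite -scaler_ractA tensA.
Qed.

Lemma tens_ract_balanced r : balanced (fun (n : N) (m : M) => tens n (m :* r)).
Proof.
split=> [n n' m|n m m'|n s m]; first by rewrite tensDl.
  by rewrite ractDl tensDr.
by rewrite scaler_ractA tensA.
Qed.

Lemma tens_scaleE t n m : tens_scale t (tens n m) = tens (t *: n) m.
Proof. exact: tens_liftE (tens_scale_balanced t) _ _. Qed.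

Lemma tens_scaleDr t : {morph tens_scale t : x y / x + y}.
Proof. by move=> x y; apply: (tens_liftD (tens_scale_balanced t)). Qed.

Lemma tens_ractE n m r : tens_ract (tens n m) r = tens n (m :* r).
Proof. exact: tens_liftE (tens_ract_balanced r) _ _. Qed.

Lemma tens_ractDl r : {morph tens_ract^~ r : x y / x + y}.
Proof. by move=> x y; apply: (tens_liftD (tens_ract_balanced r)). Qed.

Fact tens_scaleA a b x : tens_scale a (tens_scale b x) = tens_scale (a * b) x.
Proof.
elim/tens_ind: x => [n m|x y IHx IHy]; first by rewrite !tens_scaleE scalerA.
by rewrite !tens_scaleDr IHx IHy.
Qed.

Fact tens_scale1 : left_id 1 tens_scale.
Proof.
move=> x; elim/tens_ind: x => [n m|x y IHx IHy].
  by rewrite tens_scaleE scale1r.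
by rewrite tens_scaleDr IHx IHy.
Qed.

Fact tens_scaleDl x : {morph tens_scale^~ x : a b / a + b}.
Proof.
move=> a b; elim/tens_ind: x => [n m|x y IHx IHy].
  by rewrite !tens_scaleE scalerDl tensDl.
by rewrite !tens_scaleDr IHx IHy addrACA.
Qed.

HB.instance Definition _ := GRing.Zmodule_isLmodule.Build T NM
  tens_scaleA tens_scale1 tens_scaleDr tens_scaleDl.

Fact tens_ractDr x : {morph tens_ract x : r s / r + s}.
Proof.
move=> r s; elim/tens_ind: x => [n m|x y IHx IHy].
  by rewrite !tens_ractE ractDr tensDr.
by rewrite !tens_ractDl IHx IHy addrACA.
Qed.

Fact tens_ractA x r s : tens_ract (tens_ract x r) s = tens_ract x (r * s).
Proof.
elim/tens_ind: x => [n m|x y IHx IHy]; first by rewrite !tens_ractE ractA.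
by rewrite !tens_ractDl IHx IHy.
Qed.

Fact tens_ract1 x : tens_ract x 1 = x.
Proof.
elim/tens_ind: x => [n m|x y IHx IHy]; first by rewrite tens_ractE ract1.
by rewrite tens_ractDl IHx IHy.
Qed.

Fact tens_scale_ractA t x r :
  tens_ract (t *: x) r = t *: tens_ract x r.
Proof.
elim/tens_ind: x => [n m|x y IHx IHy].
  by rewrite tens_ractE /GRing.scale/= !tens_scaleE tens_ractE.
by rewrite scalerDr !tens_ractDl IHx IHy scalerDr.
Qed.

HB.instance Definition _ := Lmodule_isBimodule.Build T R NM
  tens_ractDl tens_ractDr tens_ractA tens_ract1 tens_scale_ractA.

Lemma scale_tens t (n : N) (m : M) : t *: tens n m = tens (t *: n) m.
Proof. exact: tens_scaleE. Qed.

Lemma tens_ractr (n : N) (m : M) r : tens n m :* r = tens n (m :* r).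
Proof. exact: tens_ractE. Qed.

End TensorBimodule.

Section BimodLift.
Variables (T S R : pzRingType) (N : bimodType T S) (M : bimodType S R).
Variables (P : bimodType T R) (phi : N -> M -> P).
Hypothesis phiP : balanced phi.
Hypothesis phiZ : forall t n m, phi (t *: n) m = t *: phi n m.
Hypothesis phiR : forall n m r, phi n (m :* r) = phi n m :* r.

Fact bimod_lift_linear : linear (tens_lift phi).
Proof.
move=> t x y; rewrite (tens_liftD phiP); congr (_ + _).
elim/tens_ind: x => [n m|{}x z IHx IHz].
  by rewrite scale_tens !(tens_liftE phiP) phiZ.
by rewrite scalerDr !(tens_liftD phiP) IHx IHz scalerDr.
Qed.

Fact bimod_lift_ract x r : tens_lift phi (x :* r) = tens_lift phi x :* r.
Proof.
elim/tens_ind: x => [n m|x z IHx IHz].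
  by rewrite tens_ractr !(tens_liftE phiP) phiR.
by rewrite ractDl !(tens_liftD phiP) IHx IHz ractDl.
Qed.

Definition bimod_lift : bimod_hom (tensor N M) P :=
  mk_bimod_hom bimod_lift_linear bimod_lift_ract.

Lemma bimod_liftE n m : bimod_lift (tens n m) = phi n m.
Proof. exact: tens_liftE phiP n m. Qed.

End BimodLift.

Section Regular.
Variable R : pzRingType.

Fact regular_ractDl (r : R) : {morph (fun x : R^o => x * r : R^o) : x y / x + y}.
Proof. by move=> x y; apply: mulrDl. Qed.

Fact regular_ractDr (x : R^o) : {morph (fun r : R => x * r : R^o) : r s / r + s}.
Proof. by move=> r s; apply: mulrDr. Qed.

Fact regular_ractA (x : R^o) (r s : R) : x * r * s = x * (r * s) :> R^o.
Proof. by rewrite mulrA. Qed.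

Fact regular_ract1 (x : R^o) : x * 1 = x.
Proof. exact: mulr1. Qed.

Fact regular_scale_ractA (s : R) (x : R^o) (r : R) :
  (s *: x) * r = s *: (x * r : R^o) :> R^o.
Proof. by rewrite /GRing.scale/= mulrA. Qed.

HB.instance Definition _ := Lmodule_isBimodule.Build R R R^o
  regular_ractDl regular_ractDr regular_ractA regular_ract1 regular_scale_ractA.

End Regular.

Section HComp.
Variables (T S R : pzRingType) (N N' : bimodType T S) (M M' : bimodType S R).
Variables (b : bimod_hom N N') (a : bimod_hom M M').

Fact tens_map_balanced :
  balanced (fun (n : N) (m : M) => tens (b n) (a m) : tensor N' M').
Proof.
split=> [n n' m|n m m'|n s m]; first by rewrite raddfD tensDl.
  by rewrite raddfD tensDr.
by rewrite bimod_funR linearZ tensA.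
Qed.

Fact tens_map_scale t (n : N) (m : M) :
  tens (b (t *: n)) (a m) = t *: (tens (b n) (a m)).
Proof. by rewrite linearZ scale_tens. Qed.

Fact tens_map_ract (n : N) (m : M) r :
  tens (b n) (a (m :* r)) = (tens (b n) (a m)) :* r.
Proof. by rewrite bimod_funR tens_ractr. Qed.

Definition tens_map : bimod_hom (tensor N M) (tensor N' M') :=
  bimod_lift tens_map_balanced tens_map_scale tens_map_ract.

Lemma tens_mapE n m : tens_map (tens n m) = tens (b n) (a m).
Proof. exact: bimod_liftE. Qed.

End HComp.

Section Unitors.
Variables (S R : pzRingType) (M : bimodType S R).

Fact tens_lunit_balanced : balanced (fun (s : S^o) (m : M) => (s : S) *: m).
Proof.
split=> [s s' m|s m m'|s s' m]; first exact: scalerDl.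
  exact: scalerDr.
by rewrite scalerA.
Qed.

Fact tens_lunit_scale (t : S) (s : S^o) (m : M) :
  ((t *: s : S^o) : S) *: m = t *: ((s : S) *: m).
Proof. by rewrite scalerA. Qed.

Fact tens_lunit_ract (s : S^o) (m : M) (r : R) :
  (s : S) *: (m :* r) = ((s : S) *: m) :* r.
Proof. by rewrite scaler_ractA. Qed.

Definition tens_lunit : bimod_hom (tensor S^o M) M :=
  bimod_lift tens_lunit_balanced tens_lunit_scale tens_lunit_ract.

Lemma tens_lunitE (s : S) (m : M) : tens_lunit (tens (s : S^o) m) = s *: m.
Proof. exact: bimod_liftE. Qed.

Fact tens_runit_balanced : balanced (fun (m : M) (r : R^o) => m :* (r : R)).
Proof.
split=> [m m' r|m r r'|m s r]; first exact: ractDl.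
  exact: ractDr.
by rewrite ractA.
Qed.

Fact tens_runit_scale (t : S) (m : M) (r : R^o) :
  (t *: m) :* (r : R) = t *: (m :* (r : R)).
Proof. exact: scaler_ractA. Qed.

Fact tens_runit_ract (m : M) (r : R^o) (r' : R) :
  m :* ((r :* r' : R^o) : R) = (m :* (r : R)) :* r'.
Proof. by rewrite ractA. Qed.

Definition tens_runit : bimod_hom (tensor M R^o) M :=
  bimod_lift tens_runit_balanced tens_runit_scale tens_runit_ract.

Lemma tens_runitE (m : M) (r : R) : tens_runit (tens m (r : R^o)) = m :* r.
Proof. exact: bimod_liftE. Qed.

Definition tens_lunit_inv : bimod_hom M (tensor S^o M).
Proof.
apply: (@mk_bimod_hom _ _ _ _ (fun m => tens (1 : S^o) m)) => [s m m'|m r].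
  by rewrite tensDr scale_tens -tensA /ract/= mul1r /GRing.scale/= mulr1.
by rewrite tens_ractr.
Defined.

Definition tens_runit_inv : bimod_hom M (tensor M R^o).
Proof.
apply: (@mk_bimod_hom _ _ _ _ (fun m => tens m (1 : R^o))) => [s m m'|m r].
  by rewrite tensDl scale_tens.
by rewrite tens_ractr tensA /ract/= mul1r /GRing.scale/= mulr1.
Defined.

End Unitors.

Section Associator.
Variables (Q R S T : pzRingType).
Variables (P : bimodType T S) (N : bimodType S R) (M : bimodType R Q).
Implicit Types (p : P) (n : N) (m : M).

Local Notation PN_M := (tensor (tensor P N) M).
Local Notation P_NM := (tensor P (tensor N M)).

Definition tens_assoc_left (m : M) : tensor P N -> P_NM :=
  tens_lift (fun p n => tens p (tens n m)).

Fact tens_assoc_left_balanced m :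
  balanced (fun p n => tens p (tens n m) : P_NM).
Proof.
split=> [p p' n|p n n'|p s n]; first by rewrite tensDl.
  by rewrite tensDl tensDr.
by rewrite tensA scale_tens.
Qed.

Lemma tens_assoc_leftE m p n :
  tens_assoc_left m (tens p n) = tens p (tens n m).
Proof. exact: tens_liftE (tens_assoc_left_balanced m) _ _. Qed.

Lemma tens_assoc_leftD m x y :
  tens_assoc_left m (x + y) = tens_assoc_left m x + tens_assoc_left m y.
Proof. exact: tens_liftD (tens_assoc_left_balanced m) _ _. Qed.

Fact tens_assoc_balanced :
  balanced (fun (x : tensor P N) (m : M) => tens_assoc_left m x).
Proof.
split=> [x y m|x m m'|x r m]; first exact: tens_assoc_leftD.
  elim/tens_ind: x => [p n|x y IHx IHy].
    by rewrite !tens_assoc_leftE !tensDr.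
  by rewrite !tens_assoc_leftD IHx IHy addrACA.
elim/tens_ind: x => [p n|x y IHx IHy].
  by rewrite tens_ractr !tens_assoc_leftE tensA.
by rewrite ractDl !tens_assoc_leftD IHx IHy.
Qed.

Fact tens_assoc_scale (t : T) (x : tensor P N) (m : M) :
  tens_assoc_left m (t *: x) = t *: tens_assoc_left m x.
Proof.
elim/tens_ind: x => [p n|x y IHx IHy].
  by rewrite scale_tens !tens_assoc_leftE scale_tens.
by rewrite scalerDr !tens_assoc_leftD IHx IHy scalerDr.
Qed.

Fact tens_assoc_ract (x : tensor P N) (m : M) (q : Q) :
  tens_assoc_left (m :* q) x = tens_assoc_left m x :* q.
Proof.
elim/tens_ind: x => [p n|x y IHx IHy].
  by rewrite !tens_assoc_leftE !tens_ractr.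
by rewrite !tens_assoc_leftD IHx IHy ractDl.
Qed.

Definition tens_assoc : bimod_hom PN_M P_NM :=
  bimod_lift tens_assoc_balanced tens_assoc_scale tens_assoc_ract.

Lemma tens_assocE p n m : tens_assoc (tens (tens p n) m) = tens p (tens n m).
Proof.
by rewrite (bimod_liftE tens_assoc_balanced) tens_assoc_leftE.
Qed.

Definition tens_assoc_right (p : P) : tensor N M -> PN_M :=
  tens_lift (fun n m => tens (tens p n) m).

Fact tens_assoc_right_balanced p :
  balanced (fun n m => tens (tens p n) m : PN_M).
Proof.
split=> [n n' m|n m m'|n r m]; first by rewrite tensDr tensDl.
  by rewrite tensDr.
by rewrite -tens_ractr tensA.
Qed.

Lemma tens_assoc_rightE p n m :
  tens_assoc_right p (tens n m) = tens (tens p n) m.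
Proof. exact: tens_liftE (tens_assoc_right_balanced p) _ _. Qed.

Lemma tens_assoc_rightD p x y :
  tens_assoc_right p (x + y) = tens_assoc_right p x + tens_assoc_right p y.
Proof. exact: tens_liftD (tens_assoc_right_balanced p) _ _. Qed.

Fact tens_assoc_inv_balanced :
  balanced (fun (p : P) (x : tensor N M) => tens_assoc_right p x).
Proof.
split=> [p p' x|p x y|p s x]; last first.
- elim/tens_ind: x => [n m|x y IHx IHy].
    by rewrite scale_tens !tens_assoc_rightE tensA.
  by rewrite scalerDr !tens_assoc_rightD IHx IHy.
- exact: tens_assoc_rightD.
elim/tens_ind: x => [n m|x y IHx IHy].
  by rewrite !tens_assoc_rightE !tensDl.
by rewrite !tens_assoc_rightD IHx IHy addrACA.
Qed.

Fact tens_assoc_inv_scale (t : T) (p : P) (x : tensor N M) :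
  tens_assoc_right (t *: p) x = t *: tens_assoc_right p x.
Proof.
elim/tens_ind: x => [n m|x y IHx IHy].
  by rewrite !tens_assoc_rightE !scale_tens.
by rewrite !tens_assoc_rightD IHx IHy scalerDr.
Qed.

Fact tens_assoc_inv_ract (p : P) (x : tensor N M) (q : Q) :
  tens_assoc_right p (x :* q) = tens_assoc_right p x :* q.
Proof.
elim/tens_ind: x => [n m|x y IHx IHy].
  by rewrite tens_ractr !tens_assoc_rightE tens_ractr.
by rewrite ractDl !tens_assoc_rightD IHx IHy ractDl.
Qed.

Definition tens_assoc_inv : bimod_hom P_NM PN_M :=
  bimod_lift tens_assoc_inv_balanced tens_assoc_inv_scale tens_assoc_inv_ract.

Lemma tens_assoc_invE p n m :
  tens_assoc_inv (tens p (tens n m)) = tens (tens p n) m.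
Proof.
by rewrite (bimod_liftE tens_assoc_inv_balanced) tens_assoc_rightE.
Qed.

End Associator.

(* A 1-cell from R to S is an (S, R)-bimodule. *)
Definition morita_data : bicat_data := {|
  ob := pzRingType;
  hom := fun R S => bimodType S R;
  cell := fun R S M N => bimod_hom M N;
  id1 := fun R => R^o;
  comp1 := fun R S T N M => tensor N M;
  id2 := fun R S M => bimod_id M;
  vcomp := fun R S M N P b a => bimod_comp b a;
  hcomp := fun R S T N N' M M' b a => tens_map b a;
  assoc := fun Q R S T P N M => tens_assoc P N M;
  lunit := fun R S M => tens_lunit M;
  runit := fun R S M => tens_runit M
|}.

Section MoritaBicat.
Local Open Scope bicat_scope.
Implicit Types R S T : pzRingType.

Lemma bimod_homD S R (M N : bimodType S R) (f : bimod_hom M N) x y :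
  f (x + y) = f x + f y.
Proof. exact: raddfD. Qed.

Lemma tens_hom_eq T S R (N : bimodType T S) (M : bimodType S R)
    (P : bimodType T R) (f g : bimod_hom (tensor N M) P) :
  (forall n m, f (tens n m) = g (tens n m)) -> f = g.
Proof.
move=> fg; apply: bimod_hom_eq => x.
by elim/tens_ind: x => [n m|x y IHx IHy]; rewrite ?bimod_homD ?IHx ?IHy.
Qed.

Lemma tens3_hom_eq T S R Q (P : bimodType T S) (N : bimodType S R)
    (M : bimodType R Q) (K : bimodType T Q)
    (f g : bimod_hom (tensor (tensor P N) M) K) :
  (forall p n m, f (tens (tens p n) m) = g (tens (tens p n) m)) -> f = g.
Proof.
move=> fg; apply: tens_hom_eq => x m.
by elim/tens_ind: x => [p n|x y IHx IHy];
  rewrite ?tensDl ?bimod_homD ?IHx ?IHy.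
Qed.

Lemma tens3r_hom_eq T S R Q (P : bimodType T S) (N : bimodType S R)
    (M : bimodType R Q) (K : bimodType T Q)
    (f g : bimod_hom (tensor P (tensor N M)) K) :
  (forall p n m, f (tens p (tens n m)) = g (tens p (tens n m))) -> f = g.
Proof.
move=> fg; apply: tens_hom_eq => p x.
by elim/tens_ind: x => [n m|x y IHx IHy];
  rewrite ?tensDr ?bimod_homD ?IHx ?IHy.
Qed.

Lemma tens4_hom_eq T S R Q U (L : bimodType T S) (P : bimodType S R)
    (N : bimodType R Q) (M : bimodType Q U) (K : bimodType T U)
    (f g : bimod_hom (tensor (tensor (tensor L P) N) M) K) :
  (forall l p n m,
    f (tens (tens (tens l p) n) m) = g (tens (tens (tens l p) n) m)) -> f = g.
Proof.
move=> fg; apply: tens3_hom_eq => x n m.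
by elim/tens_ind: x => [l p|x y IHx IHy];
  rewrite ?tensDl ?bimod_homD ?IHx ?IHy.
Qed.

Section Cells.
Variables (W X Y Z : morita_data).
Variables (h : hom Y Z) (g g' g'' : hom X Y) (f f' : hom W X).
Variables (b' : cell g' g'') (b : cell g g') (a : cell f f').

Lemma morita_id2E (n : g : bimodType Y X) :
  (id2 g : bimod_hom (g : bimodType Y X) g) n = n.
Proof. by []. Qed.

Lemma morita_vcompE (n : g : bimodType Y X) :
  (b' \v b : bimod_hom (g : bimodType Y X) g'') n =
  (b' : bimod_hom (g' : bimodType Y X) g'')
    ((b : bimod_hom (g : bimodType Y X) g') n).
Proof. by []. Qed.

Lemma morita_hcompE (n : g : bimodType Y X) (m : f : bimodType X W) :
  (b \h a : bimod_hom (tensor g f) (tensor g' f')) (tens n m) =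
  tens ((b : bimod_hom (g : bimodType Y X) g') n)
    ((a : bimod_hom (f : bimodType X W) f') m).
Proof. exact: tens_mapE. Qed.

Lemma morita_assocE (p : h : bimodType Z Y) (n : g : bimodType Y X)
    (m : f : bimodType X W) :
  (assoc h g f : bimod_hom (tensor (tensor h g) f) (tensor h (tensor g f)))
    (tens (tens p n) m) = tens p (tens n m).
Proof. exact: tens_assocE. Qed.

Lemma morita_lunitE (y : Y : pzRingType) (n : g : bimodType Y X) :
  (lunit g : bimod_hom (tensor (Y : pzRingType)^o g) g) (tens (y : _^o) n) =
  y *: n.
Proof. exact: tens_lunitE. Qed.

Lemma morita_runitE (n : g : bimodType Y X) (x : X : pzRingType) :
  (runit g : bimod_hom (tensor g (X : pzRingType)^o) g) (tens n (x : _^o)) =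
  n :* x.
Proof. exact: tens_runitE. Qed.

End Cells.

Definition moritaE := (morita_hcompE, morita_assocE, morita_lunitE,
  morita_runitE, morita_vcompE, morita_id2E).

Lemma morita_is_bicat : is_bicat morita_data.
Proof.
split.
- by move=> X Y f g h k c b a; apply: bimod_hom_eq.
- by move=> X Y f g a; apply: bimod_hom_eq.
- by move=> X Y f g a; apply: bimod_hom_eq.
- by move=> X Y Z g f; apply: tens_hom_eq => n m; rewrite !moritaE.
- by move=> X Y Z g g' g'' f f' f'' b' b a' a; apply: tens_hom_eq => n m;
    rewrite !moritaE.
- by move=> W X Y Z h h' g g' f f' c b a; apply: tens3_hom_eq => p n m;
    rewrite !moritaE.
- move=> W X Y Z h g f; exists (tens_assoc_inv h g f); split.
    by apply: tens3_hom_eq => p n m; rewrite !moritaE tens_assoc_invE.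
  apply: tens3r_hom_eq => p n m.
  by rewrite morita_vcompE tens_assoc_invE !moritaE.
- by move=> X Y f f' a; apply: tens_hom_eq => s m; rewrite !moritaE linearZ.
- move=> X Y f; exists (tens_lunit_inv f); split.
    apply: tens_hom_eq => s m; rewrite !moritaE.
    rewrite /tens_lunit_inv mk_bimod_homE -tensA.
    by congr tens; apply: mul1r.
  apply: bimod_hom_eq => m; rewrite morita_vcompE mk_bimod_homE.
  by apply: etrans (morita_lunitE _ _) _; apply: scale1r.
- by move=> X Y f f' a; apply: tens_hom_eq => m r; rewrite !moritaE bimod_funR.
- move=> X Y f; exists (tens_runit_inv f); split.
    apply: tens_hom_eq => m r; rewrite !moritaE.
    rewrite /tens_runit_inv mk_bimod_homE tensA.
    by congr tens; apply: mulr1.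
  apply: bimod_hom_eq => m; rewrite morita_vcompE mk_bimod_homE.
  by apply: etrans (morita_runitE _ _) _; apply: ract1.
- by move=> X Y Z g f; apply: tens3_hom_eq => n s m; rewrite !moritaE tensA.
- by move=> V W X Y Z k h g f; apply: tens4_hom_eq => l p n m; rewrite !moritaE.
Qed.

End MoritaBicat.

Definition morita : bicategory := Bicategory morita_is_bicat.

Section Center.
Variable R : pzRingType.

Definition center_pred : pred R := fun z => `[< forall r, z * r = r * z >].

Fact center_pred_closed : subring_closed center_pred.
Proof.
split=> [|x y /asboolP cx /asboolP cy|x y /asboolP cx /asboolP cy];
  apply/asboolP => r; first by rewrite mul1r mulr1.
  by rewrite mulrBl mulrBr cx cy.
by rewrite -mulrA cy mulrA cx mulrA.
Qed.

HB.instance Definition _ := GRing.isSubringClosed.Build R center_pred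
  center_pred_closed.

Definition center := {z : R | center_pred z}.

HB.instance Definition _ := SubChoice.on center.
HB.instance Definition _ :=
  GRing.SubChoice_isSubPzRing.Build R center_pred center (subringClosedP _).

Lemma centerP (z : center) r : val z * r = r * val z.
Proof. by have /asboolP := valP z; apply. Qed.

End Center.

Section Centralizer.
Variables (R S : pzRingType) (f : {rmorphism R -> S}).

Definition centralizer_pred : pred S :=
  fun s => `[< forall r, s * f r = f r * s >].

Fact centralizer_pred_closed : zmod_closed centralizer_pred.
Proof.
split=> [|x y /asboolP cx /asboolP cy]; apply/asboolP => r.
  by rewrite mul0r mulr0.
by rewrite mulrBl mulrBr cx cy.
Qed.

HB.instance Definition _ := GRing.isZmodClosed.Build S centralizer_pred
  centralizer_pred_closed.

Definition centralizer := {s : S | centralizer_pred s}.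

HB.instance Definition _ := SubChoice.on centralizer.
HB.instance Definition _ := [SubChoice_isSubZmodule of centralizer by <:].

Lemma centralizerP (x : centralizer) r : val x * f r = f r * val x.
Proof. by have /asboolP := valP x; apply. Qed.

Fact centralizer_scale_subproof (s : center S) (x : centralizer) :
  centralizer_pred (val s * val x).
Proof.
by apply/asboolP => r; rewrite -mulrA centralizerP !mulrA centerP.
Qed.

Definition centralizer_scale (s : center S) (x : centralizer) : centralizer :=
  Sub (val s * val x) (centralizer_scale_subproof s x).

Fact centralizer_ract_subproof (x : centralizer) (r : center R) :
  centralizer_pred (val x * f (val r)).
Proof.
by apply/asboolP => r'; rewrite -mulrA -rmorphM centerP rmorphM !mulrA
  centralizerP.
Qed.

Definition centralizer_ract (x : centralizer) (r : center R) : centralizer :=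
  Sub (val x * f (val r)) (centralizer_ract_subproof x r).

Fact centralizer_scaleA a b x :
  centralizer_scale a (centralizer_scale b x) = centralizer_scale (a * b) x.
Proof. by apply: val_inj; exact: mulrA. Qed.

Fact centralizer_scale1 : left_id 1 centralizer_scale.
Proof. by move=> x; apply: val_inj; exact: mul1r. Qed.

Fact centralizer_scaleDr : right_distributive centralizer_scale +%R.
Proof. by move=> s x y; apply: val_inj; exact: mulrDr. Qed.

Fact centralizer_scaleDl x : {morph centralizer_scale^~ x : a b / a + b}.
Proof. by move=> a b; apply: val_inj; exact: mulrDl. Qed.

HB.instance Definition _ := GRing.Zmodule_isLmodule.Build (center S) centralizer
  centralizer_scaleA centralizer_scale1 centralizer_scaleDr
  centralizer_scaleDl.

Fact centralizer_ractDl r : {morph centralizer_ract^~ r : x y / x + y}.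
Proof. by move=> x y; apply: val_inj; exact: mulrDl. Qed.

Fact centralizer_ractDr x : {morph centralizer_ract x : r s / r + s}.
Proof. by move=> r s; apply: val_inj; rewrite /= rmorphD mulrDr. Qed.

Fact centralizer_ractA x r s :
  centralizer_ract (centralizer_ract x r) s = centralizer_ract x (r * s).
Proof. by apply: val_inj; rewrite /= rmorphM mulrA. Qed.

Fact centralizer_ract1 x : centralizer_ract x 1 = x.
Proof. by apply: val_inj; rewrite /= rmorph1 mulr1. Qed.

Fact centralizer_scale_ractA s x r :
  centralizer_ract (s *: x) r = s *: centralizer_ract x r.
Proof. by apply: val_inj; rewrite /= mulrA. Qed.

HB.instance Definition _ :=
  Lmodule_isBimodule.Build (center S) (center R) centralizer
    centralizer_ractDl centralizer_ractDr centralizer_ractA centralizer_ract1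
    centralizer_scale_ractA.

Lemma val_centralizerZ (s : center S) (x : centralizer) :
  val (s *: x) = val s * val x.
Proof. by []. Qed.

Lemma val_centralizer_ract (x : centralizer) (r : center R) :
  val (x :* r) = val x * f (val r).
Proof. by []. Qed.

End Centralizer.

Definition center_cell (R S : pzRingType) (f g : {rmorphism R -> S})
    (e : f = g) : bimod_hom (centralizer f) (centralizer g) :=
  let: erefl := e in bimod_id (centralizer f).

(* The identity map: center R and centralizer (rmorph_id R) are convertible
   types. *)
Definition center_unit_fun (R : pzRingType) (z : (center R)^o) :
  centralizer (rmorph_id R) := z.

Section CenterUnit.
Variable R : pzRingType.

Fact center_unit_linear : linear (@center_unit_fun R).
Proof. by move=> s x y; apply: val_inj. Qed.

Fact center_unit_ract (x : (center R)^o) (r : center R) :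
  center_unit_fun (x :* r) = center_unit_fun x :* r.
Proof. exact: val_inj. Qed.

Definition center_unit :
  bimod_hom ((center R)^o : bimodType _ _) (centralizer (rmorph_id R)) :=
  mk_bimod_hom center_unit_linear center_unit_ract.

End CenterUnit.

Section CenterComp.
Variables (R S T : pzRingType).
Variables (g : {rmorphism S -> T}) (f : {rmorphism R -> S}).

Fact center_mul_subproof (t : centralizer g) (s : centralizer f) :
  centralizer_pred (rmorph_comp g f) (val t * g (val s)).
Proof.
apply/asboolP => r; rewrite -[rmorph_comp g f r]/(g (f r)).
by rewrite -mulrA -rmorphM (centralizerP s) rmorphM !mulrA (centralizerP t).
Qed.

Definition center_mul (t : centralizer g) (s : centralizer f) :
    centralizer (rmorph_comp g f) :=
  Sub (val t * g (val s)) (center_mul_subproof t s).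

Fact center_mul_balanced : balanced center_mul.
Proof.
split=> [t t' s|t s s'|t z s]; apply: val_inj.
- exact: mulrDl.
- by rewrite /= rmorphD mulrDr.
- by rewrite /= rmorphM mulrA.
Qed.

Fact center_mul_scale (z : center T) t s :
  center_mul (z *: t) s = z *: center_mul t s.
Proof. by apply: val_inj; rewrite /= mulrA. Qed.

Fact center_mul_ract t s (z : center R) :
  center_mul t (s :* z) = center_mul t s :* z.
Proof. by apply: val_inj; rewrite /= rmorphM mulrA. Qed.

Definition center_comp :
  bimod_hom (tensor (centralizer g) (centralizer f))
    (centralizer (rmorph_comp g f)) :=
  bimod_lift center_mul_balanced center_mul_scale center_mul_ract.

Lemma center_compE (t : centralizer g) (s : centralizer f) :
  val (center_comp (tens t s)) = val t * g (val s).
Proof. by rewrite bimod_liftE. Qed.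

End CenterComp.

Definition center_lax : lax_data ring_bicat morita :=
  @LaxData ring_bicat morita
    center
    (fun (R S : pzRingType) (f : {rmorphism R -> S}) => centralizer f)
    center_cell
    center_unit
    center_comp.

(* Main.v *)
Require Import Defs.
From mathcomp Require Import all_boot all_algebra.
Import GRing.Theory.

(** Functoriality and naturality are immediate because the only 2-cells between
    ring homomorphisms are identities.  The three coherence axioms compare
    additive maps from a tensor product into a centralizer, which is a subset
    of its codomain ring, so each may be checked on pure tensors and after
    forgetting into that ring.  There the composition cell is the formula
    [t * g s] ([center_compE]), the unit cell is the identity, and a cell coming
    from an equality of ring homomorphisms acts trivially ([val_center_cell]).
    Both unity axioms then hold by definition: for [s] in the centralizer of [f]
    and [z] central, the two composites are [z * s] and [s * f z], which are the
    left and right actions on the centralizer, that is, the unitors.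
    Associativity becomes [u * h t * h (g s) = u * h (t * g s)], which is the
    multiplicativity of [h]. *)

(** The associator and unitors of the source bicategory are opaque equality
    proofs, so transport along them does not compute; on underlying ring
    elements it is nevertheless the identity. *)
Lemma val_center_cell (R S : pzRingType) (f g : {rmorphism R -> S})
    (e : f = g) (x : centralizer f) : val (center_cell e x) = val x.
Proof. by case: g / e. Qed.

Theorem theorem4p4 : is_lax_functor center_lax.
Proof.
split.
- by [].
- by move=> R S f g h b a; case: h / b; case: g / a; apply: bimod_hom_eq.
- move=> R S T g g' f f' b a; case: g' / b; case: f' / a.
  by apply: tens_hom_eq => t s; apply: val_inj; rewrite !moritaE.
- move=> R S f; apply: tens_hom_eq => z s; apply: val_inj.
  by rewrite !moritaE val_center_cell center_compE.
- move=> R S f; apply: tens_hom_eq => s z; apply: val_inj.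
  by rewrite !moritaE val_center_cell center_compE.
- move=> Q R S T h g f; apply: tens3_hom_eq => u t s; apply: val_inj.
  rewrite !moritaE val_center_cell !center_compE /=.
  by rewrite rmorphM mulrA.
Qed.
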